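(* For every $\bar\theta=\langle(\varepsilon_n,\bar a_n)\rangle_{n\ge1}\in\overline\Sigma^{\mathbb N}$, the time group $\mathcal T^{\mathrm{gp}}_{\bar\theta}$ admits a unique translation-invariant total order $<$ with the property that for all $n\ge0$, (1) $0<\mathfrak q_{[n]}<\mathfrak q_{[n+1]}$; (2) if $\bar a_{n+1}=\infty$, then $k\,\mathfrak q_{[n]}<\mathfrak q_{[n+1]}$ for all $k\ge1$.
   Context: $\overline{\mathbb N}=\mathbb N\cup\{\infty\}$ with $\mathbb N=\{1,2,\dots\}$, $\overline\Sigma=\{-1,+1\}\times\overline{\mathbb N}_{\ge2}$, and $\overline\Sigma^{\mathbb N}$ is the set of sequences $\langle(\varepsilon_n,\bar a_n)\rangle_{n\ge1}$ in $\overline\Sigma$. An integer $n\ge0$ is a parabolic level if $\bar a_{n+1}=\infty$. For $n\ge1$ with $\bar a_n<\infty$, $b_n=\bar a_n+\frac{1+\varepsilon_n\varepsilon_{n+1}}2$. The time group $\mathcal T^{\mathrm{gp}}_{\bar\theta}$ is the additive abelian group generated by $\{\mathfrak q_{[n]}\}_{n\ge0}$ subject to the relations $\mathfrak q_{[n+1]}=b_{n+1}\mathfrak q_{[n]}-\varepsilon_n\varepsilon_{n+1}\mathfrak q_{[n-1]}$ for every $n\ge0$ that is not a parabolic level, where $\mathfrak q_{[-1]}=0$ is the identity (so for $n=0$ the relation reads $\mathfrak q_{[1]}=b_1\mathfrak q_{[0]}$). *)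

(* Defs.v *)
From HB Require Import structures.
From mathcomp Require Import all_boot all_order all_algebra.
From mathcomp Require Import generic_quotient ring_quotient.
From mathcomp Require Import boolp.
From mathcomp.multinomials Require Export freeg.

Set Implicit Arguments.
Unset Strict Implicit.
Unset Printing Implicit Defensive.

Import GRing.Theory.
Export Quotient.Exports.

Local Open Scope ring_scope.
Local Open Scope quotient_scope.

(* The second component [None] stands for infinity. *)
Definition in_Sigma (s : int * option nat) : bool :=
  ((s.1 == -1) || (s.1 == 1)) && (if s.2 is Some a then (2 <= a)%N else true).

Definition Sigma : Type := {s : int * option nat | in_Sigma s}.

(* A sequence indexed by n >= 1 is encoded as theta : nat -> Sigma, with
   theta i the entry of index i + 1; thus eps theta n and abar theta n are the
   entries of index n for n >= 1, and only these indices are meaningful. *)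
Definition eps (theta : nat -> Sigma) (n : nat) : int :=
  (val (theta n.-1)).1.

Definition abar (theta : nat -> Sigma) (n : nat) : option nat :=
  (val (theta n.-1)).2.

Definition parabolic_level (theta : nat -> Sigma) (n : nat) : bool :=
  abar theta n.+1 == None.

(* The division is exact. Only used when abar theta n is finite. *)
Definition b (theta : nat -> Sigma) (n : nat) : int :=
  (odflt 0%N (abar theta n))%:Z
    + ((1 + eps theta n * eps theta n.+1) %/ 2)%Z.

Definition subgroup_gen (V : zmodType) (S : V -> Prop) (x : V) : bool :=
  `[< forall H : zmodClosed V, (forall y, S y -> y \in H) -> x \in H >].

Lemma subgroup_gen_zmod_closed (V : zmodType) (S : V -> Prop) :
  zmod_closed (subgroup_gen S).
Proof.
split; first by apply/asboolP => H _; exact: rpred0.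
move=> x y /asboolP Hx /asboolP Hy; apply/asboolP => H SH.
by apply: rpredB; [exact: Hx | exact: Hy].
Qed.

HB.instance Definition _ (V : zmodType) (S : V -> Prop) :=
  GRing.isZmodClosed.Build V (subgroup_gen S) (subgroup_gen_zmod_closed S).

Definition free_q (n : nat) : {freeg nat} := << n >>.

(* q_[n-1], with the convention q_[-1] = 0; hence the junk value of eps at
   index 0 does not enter the relator of index 0. *)
Definition free_qpred (n : nat) : {freeg nat} :=
  if n is m.+1 then free_q m else 0.

Definition relator (theta : nat -> Sigma) (n : nat) : {freeg nat} :=
  free_q n.+1
    - (free_q n *~ b theta n.+1
       - free_qpred n *~ (eps theta n * eps theta n.+1)).

Definition is_relator (theta : nat -> Sigma) (x : {freeg nat}) : Prop :=
  exists2 n, ~~ parabolic_level theta n & x = relator theta n.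

Definition relations (theta : nat -> Sigma) : zmodClosed {freeg nat} :=
  GRing.ZmodClosed.clone _ (subgroup_gen (is_relator theta)) _.

Definition time_group (theta : nat -> Sigma) : zmodType :=
  Quotient.quot (relations theta).

Definition q (theta : nat -> Sigma) (n : nat) : time_group theta :=
  \pi_(Quotient.quot (relations theta)) (free_q n).

Definition strict_total_order (T : eqType) (lt : rel T) : Prop :=
  [/\ irreflexive lt, transitive lt
    & forall x y, x != y -> lt x y || lt y x].

Definition translation_invariant (G : zmodType) (lt : rel G) : Prop :=
  forall x y z, lt x y -> lt (x + z) (y + z).

(* Main.v *)
Require Import Defs.
From HB Require Import structures.
From mathcomp Require Import all_boot all_order all_algebra.
From mathcomp Require Import generic_quotient ring_quotient boolp.
Import Order.TTheory GRing.Theory Num.Theory.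

Set Implicit Arguments.
Unset Strict Implicit.
Unset Printing Implicit Defensive.
Local Open Scope ring_scope.
Local Open Scope quotient_scope.

(** The relations determine [q n.+1] from the earlier generators except at a
parabolic level [n], where [q n.+1] is a new free generator.  So the time group
is free abelian on [q 0] and the [q n.+1] with [n] parabolic.  Two conditions are
imposed on the order: monotonicity, [0 < q n < q n.+1], and domination,
[k q n < q n.+1] for all [k] when [n] is parabolic.  Domination makes each basis
element infinitely larger than the ones before it, so the order must be the
lexicographic one, in which the sign of an element is the sign of its leading
coordinate.

Coordinates are stored in an integer polynomial, the basis element [q i] having
its coordinate at ['X^i].  [coord] is this coordinate map; it is injective
because the linear combination map [comb], sending ['X^i] to [q i], is a left
inverse ([coordK]).  An element is declared positive when the leading
coefficient of its coordinates is, and [time_pos_dominating] checks the two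
conditions.  Monotonicity at a level [n] that is not parabolic holds because
[q n.+1 - q n = (b - 2) q n + (q n - s q n.-1)] with [b >= 2] and [s = 1] or
[s = -1], so that [q n > 0] and [q n > q n.-1 >= 0] give [q n.+1 > q n]
([qpoly_pos_increasing]).

For uniqueness, let [x] have leading coordinate [c > 0] at ['X^d].  Coordinates
vanish outside the basis indices ([coord_support]), hence [d = 0] and
[x = c q 0], or [d = n.+1] with [n] parabolic.  In the second case the lower
terms only involve [q i] with [i <= n], so in any admissible order they exceed
[- m q n] for some [m] ([comb_bounded]), while [q d > m q n] by domination; thus
[x > 0] ([cone_sup]).  Two total orders one of which refines the other are
equal ([sub_cone_eq]). *)

(** * Invariant orders and their cones of positive elements *)

Definition positive_cone (G : zmodType) (P : pred G) : Prop :=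
  [/\ ~~ P 0, forall x y, P x -> P y -> P (x + y)
    & forall x, x != 0 -> P x || P (- x)].

Section Cones.
Variable G : zmodType.
Implicit Types (P Q : pred G) (lt : rel G).

Lemma order_of_cone P : positive_cone P ->
  strict_total_order (fun x y => P (y - x)) /\
  translation_invariant (fun x y => P (y - x)).
Proof.
move=> [P0 PD Ptot]; split; last first.
  by move=> x y z; rewrite opprD addrACA subrr addr0.
split=> [x|y x z Pxy Pyz|x y].
- by rewrite subrr; apply/negbTE.
- have -> : z - x = (y - x) + (z - y) by rewrite [RHS]addrC addrA subrK.
  exact: PD.
- by rewrite eq_sym -subr_eq0 => /Ptot; rewrite opprB.
Qed.

Lemma invariant_ltE lt x y : translation_invariant lt -> lt x y = lt 0 (y - x).
Proof.
move=> ltD; apply/idP/idP => [/(ltD _ _ (- x))|/(ltD _ _ x)].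
  by rewrite subrr.
by rewrite add0r subrK.
Qed.

Lemma cone_of_order lt :
  strict_total_order lt -> translation_invariant lt -> positive_cone (lt 0).
Proof.
move=> [ltxx lt_trans lt_tot] ltD; split=> [|x y x_gt0 y_gt0|x xN0].
- by rewrite ltxx.
- by apply: lt_trans x_gt0 _; rewrite invariant_ltE // addrAC subrr add0r.
- by have := lt_tot _ _ xN0; rewrite orbC (invariant_ltE x 0) // sub0r.
Qed.

(** A total cone is maximal: if [x] is only in the larger cone, then [- x] is in
the smaller one, so the larger one contains both, hence also 0. *)
Lemma sub_cone_eq P Q :
  positive_cone P -> positive_cone Q -> (forall x, P x -> Q x) -> P =1 Q.
Proof.
move=> [P0 _ Ptot] [Q0 QD _] PQ x; apply/idP/idP => [/PQ //|Qx].
have xN0 : x != 0 by apply: contraTneq Qx => ->.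
case/orP: (Ptot x xN0) => // /PQ QNx.
by case/negP: Q0; rewrite -(subrr x) QD.
Qed.

Lemma coneMn P x k : positive_cone P -> P x -> P (x *+ k.+1).
Proof.
move=> [_ PD _] Px; elim: k => [|k IHk]; first by rewrite mulr1n.
by rewrite mulrSr PD.
Qed.

Lemma cone_trans P x y : positive_cone P -> P (y - x) -> P x -> P y.
Proof. by move=> [_ PD _] Pyx Px; rewrite -(subrK x y) PD. Qed.

End Cones.

(** * The lexicographic order on integer polynomials *)

Definition lead_pos (p : {poly int}) : bool := 0 < lead_coef p.

Lemma lead_pos_cone : positive_cone lead_pos.
Proof.
rewrite /lead_pos; split=> [|p r p_gt0 r_gt0|p p_neq0].
- by rewrite lead_coef0 ltxx.
- case: (ltngtP (size p) (size r)) => [lt_pr|lt_rp|eq_pr].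
  + by rewrite lead_coefDr.
  + by rewrite lead_coefDl.
  have coef_gt0 : 0 < (p + r)`_(size p).-1.
    by rewrite coefD {2}eq_pr -!lead_coefE addr_gt0.
  suff size_pr : size (p + r)%R = size p by rewrite lead_coefE size_pr.
  apply/eqP; rewrite eqn_leq; apply/andP; split.
    by rewrite (leq_trans (size_polyD _ _)) // -eq_pr maxnn.
  rewrite leqNgt; apply/negP => lt_size; move: coef_gt0.
  by rewrite nth_default ?ltxx // -ltnS (ltn_predK lt_size).
- by rewrite lead_coefN oppr_gt0 -neq_lt eq_sym lead_coef_eq0.
Qed.

(** * Coordinates on the time group *)

Section TimeGroup.
Variable theta : nat -> Sigma.
Local Notation G := (time_group theta).
Local Notation q := (q theta).

(** Serves to prove that two additive maps on the time group agree, or that an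
additive map takes values in a subgroup, by looking at the generators. *)
Lemma time_group_ind (P : G -> Prop) :
    P 0 -> (forall x y, P x -> P y -> P (x - y)) -> (forall n, P (q n)) ->
  forall x, P x.
Proof.
move=> P0 PB Pq.
have PN x : P x -> P (- x) by move=> Px; rewrite -sub0r; apply: PB.
have PD x y : P x -> P y -> P (x + y).
  by move=> Px Py; rewrite -(opprK y); apply/PB/PN.
have PMn x k : P x -> P (x *+ k).
  by move=> Px; elim: k => // k IHk; rewrite mulrS; apply: PD.
elim/quotW=> D; rewrite -(freeg_sumE D) raddf_sum.
apply: (big_ind P) => // n _.
have -> : << coeff n D *g n >> = free_q n *~ coeff n D.
  by rewrite freeg_mulz intz.
rewrite raddfMz; case: (coeff n D) => k; first by apply/PMn/Pq.
by apply/PN/PMn/Pq.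
Qed.

Definition qpred n : G := if n is m.+1 then q m else 0.

Lemma q_rec n : ~~ parabolic_level theta n ->
  q n.+1 = q n *~ b theta n.+1 - qpred n *~ (eps theta n * eps theta n.+1).
Proof.
move=> npar.
have -> : qpred n = \pi_(Quotient.quot (relations theta)) (free_qpred n).
  by case: n {npar} => [|n] //=; rewrite raddf0.
rewrite -!raddfMz -raddfB; apply/eqP; rewrite -Quotient.idealrBE.
apply/asboolP => H; apply; by exists n.
Qed.

(** The coordinates of [q n].  The new basis element at a parabolic level [m] is
placed at degree [m.+1], not at the next free degree: degrees skipped this way
do no harm to the lexicographic order, and the degree of [qpoly n] stays at most
[n] without counting parabolic levels. *)
Fixpoint qpoly n : {poly int} :=
  if n is m.+1 then
    if parabolic_level theta m then 'X^(m.+1)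
    else qpoly m *~ b theta m.+1
      - (if m is k.+1 then qpoly k else 0) *~ (eps theta m * eps theta m.+1)
  else 1.

Definition qpoly_pred n := if n is m.+1 then qpoly m else 0.

Lemma qpoly_parabolic n : parabolic_level theta n -> qpoly n.+1 = 'X^(n.+1).
Proof. by move=> /= ->. Qed.

Lemma qpoly_rec n : ~~ parabolic_level theta n ->
  qpoly n.+1
    = qpoly n *~ b theta n.+1 - qpoly_pred n *~ (eps theta n * eps theta n.+1).
Proof. by move=> /= /negbTE ->. Qed.

Definition free_coord : {freeg nat} -> {poly int} := fglift qpoly.

HB.instance Definition _ :=
  GRing.isZmodMorphism.Build {freeg nat} {poly int} free_coord
    (lift_is_additive qpoly).

Lemma free_coord_q n : free_coord (free_q n) = qpoly n.
Proof. by rewrite /free_coord liftU scale1r. Qed.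

Lemma free_coord_qpred n : free_coord (free_qpred n) = qpoly_pred n.
Proof. by case: n => [|n]; [exact: raddf0 | exact: free_coord_q]. Qed.

Lemma free_coord_relator n :
  ~~ parabolic_level theta n -> free_coord (relator theta n) = 0.
Proof.
move=> npar; rewrite /relator raddfB raddfB !raddfMz /=.
by rewrite !free_coord_q free_coord_qpred qpoly_rec // mulNrz subrr.
Qed.

(** The kernel of [free_coord] is made a closed predicate because the subgroup
of relations is the intersection of all such predicates containing the
relators. *)
Definition free_coord_ker : pred {freeg nat} := fun D => free_coord D == 0.

Lemma free_coord_ker_closed : zmod_closed free_coord_ker.
Proof.
split; rewrite /free_coord_ker ?unfold_in ?raddf0 // => D E.
rewrite !unfold_in => /eqP ED /eqP EE.
by rewrite raddfB /= ED EE subrr.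
Qed.

HB.instance Definition _ :=
  GRing.isZmodClosed.Build {freeg nat} free_coord_ker free_coord_ker_closed.

Definition coord (x : G) : {poly int} := free_coord (repr x).

Lemma coord_pi D :
  coord (\pi_(Quotient.quot (relations theta)) D) = free_coord D.
Proof.
apply/eqP; rewrite -subr_eq0 -raddfB.
have: repr (\pi_(Quotient.quot (relations theta)) D) - D \in relations theta.
  by rewrite Quotient.idealrBE reprK.
move=> /asboolP /(_ (GRing.ZmodClosed.clone _ free_coord_ker _)).
apply=> _ [n npar ->].
by rewrite unfold_in /free_coord_ker free_coord_relator.
Qed.

Lemma coord_is_additive : zmod_morphism coord.
Proof.
elim/quotW=> D; elim/quotW=> E.
by rewrite -raddfB !coord_pi raddfB.
Qed.

HB.instance Definition _ :=
  GRing.isZmodMorphism.Build G {poly int} coord coord_is_additive.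

Lemma coord_q n : coord (q n) = qpoly n.
Proof. by rewrite coord_pi free_coord_q. Qed.

Definition comb (p : {poly int}) : G := \sum_(i < size p) q i *~ p`_i.

Lemma comb_widen m (p : {poly int}) :
  (size p <= m)%N -> comb p = \sum_(i < m) q i *~ p`_i.
Proof.
move=> le_pm; rewrite /comb (big_ord_widen m (fun i => q i *~ p`_i)) //.
rewrite big_mkcond; apply: eq_bigr => i _.
by case: ltnP => // ?; rewrite nth_default ?mulr0z.
Qed.

Lemma comb_is_additive : zmod_morphism comb.
Proof.
move=> p r; pose m := maxn (size p) (size r).
rewrite (@comb_widen m p) ?leq_maxl // (@comb_widen m r) ?leq_maxr //.
rewrite (@comb_widen m) -?sumrB; last first.
  by rewrite (leq_trans (size_polyD _ _)) ?size_polyN.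
by apply: eq_bigr => i _; rewrite coefB mulrzBr.
Qed.

HB.instance Definition _ :=
  GRing.isZmodMorphism.Build {poly int} G comb comb_is_additive.

Lemma combXn n : comb 'X^n = q n.
Proof.
rewrite (@comb_widen n.+1) ?size_polyXn // (bigD1 ord_max) //= coefXn eqxx.
rewrite big1 ?addr0 // => i; rewrite coefXn -val_eqE /= => /negbTE ->.
by rewrite mulr0z.
Qed.

Lemma comb_qpoly n : comb (qpoly n) = q n.
Proof.
suff: comb (qpoly n) = q n /\ comb (qpoly_pred n) = qpred n by case.
elim: n => [|n [IHq IHp]]; first by rewrite -(combXn 0) expr0 raddf0.
split=> //; case: (boolP (parabolic_level theta n)) => [par|npar].
  by rewrite qpoly_parabolic // combXn.
by rewrite qpoly_rec // q_rec // raddfB !(raddfMz comb) /= IHq IHp.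
Qed.

(** In particular [coord] is injective, so that a nonzero element has a nonzero
leading coordinate; totality of the order rests on this. *)
Lemma coordK : cancel coord comb.
Proof.
elim/time_group_ind=> [|x y Ex Ey|n]; first by rewrite !raddf0.
  by rewrite !raddfB /= Ex Ey.
by rewrite coord_q comb_qpoly.
Qed.

Lemma size_qpoly n : (size (qpoly n) <= n.+1)%N.
Proof.
have sizeMz (p : {poly int}) m c : (size p <= m)%N -> (size (p *~ c) <= m)%N.
  by move=> le_pm; rewrite -scaler_int (leq_trans (size_scale_leq _ _)).
suff: (size (qpoly n) <= n.+1)%N /\ (size (qpoly_pred n) <= n)%N by case.
elim: n => [|n [IHq IHp]]; first by rewrite /= size_poly1 size_poly0.
split=> //; case: (boolP (parabolic_level theta n)) => [par|npar].
  by rewrite qpoly_parabolic // size_polyXn.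
rewrite qpoly_rec // (leq_trans (size_polyD _ _)) // size_polyN geq_max.
by rewrite !sizeMz // ?(leq_trans IHq) // ?(leq_trans IHp) //; apply/ltnW.
Qed.

(** The basis consists of [q 0] and the [q n.+1] with [n] parabolic: the
polynomial recursion creates a new monomial only at a parabolic level. *)
Lemma coord_support i x :
  (coord x)`_i != 0 -> i = 0%N \/ exists2 n, parabolic_level theta n & i = n.+1.
Proof.
case: i => [|i]; first by left.
move=> xi; right; exists i => //; apply: contraNT xi => npar.
elim/time_group_ind: x => [|x y /eqP Ex /eqP Ey|n].
- by rewrite raddf0 coef0.
- by rewrite raddfB coefB Ex Ey.
rewrite coord_q; apply/eqP.
suff: (qpoly n)`_i.+1 = 0 /\ (qpoly_pred n)`_i.+1 = 0 by case.
elim: n => [|n [IHq IHp]]; first by rewrite /= coef1 coef0.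
split=> //; case: (boolP (parabolic_level theta n)) => [par|npar'].
  rewrite qpoly_parabolic // coefXn eqSS; case: eqP => // eq_in.
  by rewrite eq_in par in npar.
by rewrite qpoly_rec // coefB !coefMrz IHq IHp !mul0rz.
Qed.

Lemma eps_mul m n :
  (eps theta m * eps theta n == -1) || (eps theta m * eps theta n == 1).
Proof.
rewrite /eps; case: (theta m.-1) (theta n.-1) => [[e a] /= He] [[f c] /= Hf].
case/andP: He => /orP[]/= /eqP -> _;
by case/andP: Hf => /orP[]/= /eqP -> _.
Qed.

Lemma b_ge2 n : ~~ parabolic_level theta n -> 2 <= b theta n.+1.
Proof.
rewrite /parabolic_level /b => npar; apply: ler_wpDr.
  by case/orP: (eps_mul n.+1 n.+2) => /eqP ->.
move: npar; rewrite /abar; case: (theta _) => [[e [a|]] /andP[_ /= Ha]] //.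
Qed.

(** * Existence *)

(** The step uses that the previous term is nonnegative and below [qpoly n]; for
[n = 0] this holds by the convention that the term of index [-1] is zero. *)
Lemma qpoly_pos_increasing n :
  lead_pos (qpoly n) /\ lead_pos (qpoly n.+1 - qpoly n).
Proof.
have [_ PD _] := lead_pos_cone.
have step m : lead_pos (qpoly m) -> lead_pos (qpoly m - qpoly_pred m) ->
    qpoly_pred m = 0 \/ lead_pos (qpoly_pred m) ->
  lead_pos (qpoly m.+1 - qpoly m).
  move=> q_gt0 dq_gt0 qp_ge0.
  case: (boolP (parabolic_level theta m)) => [par|npar].
    rewrite qpoly_parabolic // /lead_pos lead_coefDl ?lead_coefXn //.
    by rewrite size_polyN size_polyXn ltnS size_qpoly.
  have [k bE] : exists k : nat, b theta m.+1 = k%:Z + 2.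
    by exists `|b theta m.+1 - 2|%N; rewrite gez0_abs ?subrK // subr_ge0 b_ge2.
  (* For either sign, the previous term is too small to cancel [qpoly m]. *)
  have lin_gt0 :
      lead_pos (qpoly m - qpoly_pred m *~ (eps theta m * eps theta m.+1)).
    case/orP: (eps_mul m m.+1) => /eqP ->; last by rewrite mulr1z.
    rewrite mulrNz opprK mulr1z.
    by case: qp_ge0 => [->|?]; [rewrite addr0 | exact: PD].
  have -> : qpoly m.+1 - qpoly m = qpoly m *+ k
      + (qpoly m - qpoly_pred m *~ (eps theta m * eps theta m.+1)).
    rewrite qpoly_rec // bE mulrzDr -[_ *~ 2]/(_ + _) -pmulrn.
    by rewrite [LHS]addrAC !addrA addrK.
  case: k {bE} => [|k]; first by rewrite mulr0n add0r.
  by apply: PD => //; apply: coneMn lead_pos_cone _.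
suff: [/\ lead_pos (qpoly n), lead_pos (qpoly n - qpoly_pred n)
        & qpoly_pred n = 0 \/ lead_pos (qpoly_pred n)].
  by case=> q_gt0 dq_gt0 qp_ge0; split=> //; apply: step.
elim: n => [|n [q_gt0 dq_gt0 qp_ge0]].
  by rewrite /= subr0 /lead_pos lead_coef1; split=> //; left.
have dq'_gt0 := step n q_gt0 dq_gt0 qp_ge0.
split; [exact: cone_trans lead_pos_cone dq'_gt0 q_gt0 | by [] | by right].
Qed.

Definition time_pos : pred G := fun x => lead_pos (coord x).

Lemma time_pos_cone : positive_cone time_pos.
Proof.
have [P0 PD Ptot] := lead_pos_cone.
split=> [|x y x_gt0 y_gt0|x x_neq0]; rewrite /time_pos.
- by rewrite raddf0.
- by rewrite raddfD PD.
- rewrite raddfN Ptot //; apply: contraNneq x_neq0 => x0.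
  by rewrite -(coordK x) x0 raddf0.
Qed.

(** Monotonicity and domination of an order, in terms of its positive elements.
The case [k = 0] adds nothing, since [q n.+1] is positive. *)
Definition dominating (P : pred G) : Prop :=
  forall n, [/\ P (q n), P (q n.+1 - q n) &
    parabolic_level theta n -> forall k, P (q n.+1 - q n *+ k)].

Lemma time_pos_dominating : dominating time_pos.
Proof.
move=> n; have [q_gt0 dq_gt0] := qpoly_pos_increasing n.
rewrite /time_pos; split=> [||par k];
  rewrite ?raddfB ?(raddfMn coord) /= !coord_q //.
rewrite qpoly_parabolic // /lead_pos lead_coefDl ?lead_coefXn //.
rewrite size_polyN size_polyXn ltnS (leq_trans _ (size_qpoly n)) //.
by rewrite -scaler_nat (leq_trans (size_scale_leq _ _)).
Qed.

(** * Uniqueness *)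

Section Uniqueness.
Variable P : pred G.
Hypotheses (coneP : positive_cone P) (domP : dominating P).

Lemma cone_q_le m n : (m <= n)%N -> q m = q n \/ P (q n - q m).
Proof.
have [_ PD _] := coneP.
elim: n => [|n IHn]; first by rewrite leqn0 => /eqP ->; left.
rewrite leq_eqVlt ltnS => /orP[/eqP ->|/IHn]; first by left.
have [_ dq _] := domP n.
by case=> [->|mn]; right=> //; rewrite -(subrKA (q n)) PD.
Qed.

(** The elements bounded below by a multiple of [- q n] are closed under
addition, so it suffices to treat [q i] and [- q i] for [i <= n]. *)
Lemma comb_bounded (n : nat) (p : {poly int}) : (size p <= n.+1)%N ->
  exists k, P (comb p + q n *+ k).
Proof.
move=> size_p; have [_ PD _] := coneP; have [qn_gt0 _ _] := domP n.
pose B x := exists k, P (x + q n *+ k).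
have BD x y : B x -> B y -> B (x + y).
  by move=> [k Bk] [l Bl]; exists (k + l)%N; rewrite mulrnDr addrACA PD.
have B0 : B 0 by exists 1%N; rewrite add0r.
have BMn x k : B x -> B (x *+ k).
  by move=> Bx; elim: k => // k IHk; rewrite mulrS; apply: BD.
rewrite (comb_widen size_p); apply: (big_ind B) => // i _.
case: (p`_i) => k.
  apply: BMn; exists 1%N; have [qi_gt0 _ _] := domP i; exact: PD.
rewrite NegzE mulrNz -mulNrz; apply: (BMn _ k.+1).
have [->|lt_in] := cone_q_le (ltn_ord i : (i <= n)%N).
  (* [- q n] needs the multiple 2 because the bound is strict. *)
  by exists 2%N; rewrite mulr2n addKr; have [] := domP i.
by exists 1%N; rewrite addrC.
Qed.

(** The leading coordinate decides the sign: its basis element exceeds every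
multiple of the generator just before it, which bounds all lower terms. *)
Lemma cone_sup x : time_pos x -> P x.
Proof.
rewrite /time_pos /lead_pos => x_gt0; rewrite -(coordK x).
have [_ PD _] := coneP.
set p := coord x in x_gt0 *.
have p_neq0 : p != 0 by rewrite -lead_coef_eq0 gt_eqF.
have size_p := polySpred p_neq0; set d := (size p).-1 in size_p.
pose r := p - lead_coef p *: 'X^d.
have -> : comb p = q d *~ lead_coef p + comb r.
  rewrite raddfB /= -{2}[lead_coef p]intz scaler_int raddfMz /= combXn.
  by rewrite addrC subrK.
have [k ->] : exists k : nat, lead_coef p = k.+1%:Z.
  by move: x_gt0; case: (lead_coef p) => [[|k]|] // _; exists k.
have size_r : (size r <= d)%N.
  apply/leq_sizeP=> j le_dj; rewrite coefB coefZ coefXn.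
  case: eqP => [->|/eqP neq_jd]; first by rewrite mulr1 lead_coefE subrr.
  by rewrite mulr0 subr0 nth_default // size_p ltn_neqAle eq_sym neq_jd.
have qd_gt0 : P (q d) by have [] := domP d.
suff lower : P (q d + comb r).
  case: (k) => [|l]; first by rewrite mulr1z.
  by rewrite -pmulrn mulrSr -addrA PD //; apply: coneMn.
have xd_neq0 : (coord x)`_d != 0 by rewrite -lead_coefE lead_coef_eq0.
(* If [d = 0] there are no lower terms; otherwise [d.-1] is parabolic. *)
have [d0|[n par dn]] := coord_support xd_neq0.
- have -> : r = 0 by apply/eqP; rewrite -size_poly_leq0 -d0.
  by rewrite raddf0 addr0.
rewrite dn in size_r *; have [m Pm] := comb_bounded size_r.
have [_ _ /(_ par m) sup] := domP n.
have -> : q n.+1 + comb r = (q n.+1 - q n *+ m) + (comb r + q n *+ m).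
  by rewrite [RHS]addrACA addNr addr0.
exact: PD.
Qed.

End Uniqueness.

End TimeGroup.

Theorem proposition4p12 (theta : nat -> Sigma) :
  exists! lt : rel (time_group theta),
    [/\ strict_total_order lt,
        translation_invariant lt &
        forall n : nat,
          [/\ lt 0 (q theta n), lt (q theta n) (q theta n.+1) &
              abar theta n.+1 = None ->
              forall k : nat, (1 <= k)%N ->
                lt (q theta n *+ k) (q theta n.+1)]].
Proof.
have [lt_order lt_inv] := order_of_cone (time_pos_cone theta).
exists (fun x y => time_pos (y - x)); split.
  split=> // n; have [q_gt0 dq_gt0 par] := time_pos_dominating theta n.
  by split=> [||/eqP ? k _]; rewrite ?subr0 //; apply: par.
move=> lt [lt_order' lt_inv' ltP].
have cone' := cone_of_order lt_order' lt_inv'.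
have dom' : dominating (lt 0).
  move=> n; have [q_gt0 dq_gt0 par] := ltP n.
  split; rewrite -?invariant_ltE // => /eqP par_n [|k].
    by rewrite subr0; have [] := ltP n.+1.
  by rewrite -invariant_ltE // par.
apply/funext=> x; apply/funext=> y; rewrite (invariant_ltE x y lt_inv').
by apply: sub_cone_eq (cone_sup cone' dom') _; first exact: time_pos_cone.
Qed.
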